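(* Let $\delta\ge0$. A metric space $X$ is $(1,\delta)$-hyperbolic if and only if $X$ is Gromov $\delta$-hyperbolic.
   Context: A metric space $(X,d)$ is $(1,\delta)$-hyperbolic if for every family $(x_i)_{i\in I}$ of points of $X$ indexed by $I=\{\pm1,\pm2\}$ there is a permutation $\alpha\ne-\mathrm{id}$ of $I$ with $\sum_{i\in I}d(x_i,x_{-i})\le\sum_{i\in I}d(x_i,x_{\alpha(i)})+2\delta$. $X$ is Gromov $\delta$-hyperbolic if for every quadruple $(x,x',y,y')$ of points in $X$, $d(x,x')+d(y,y')\le\max\{d(x,y)+d(x',y'),\,d(x,y')+d(x',y)\}+2\delta$. *)

(* Defs.v *)
From mathcomp Require Import all_boot all_order all_algebra perm.
From mathcomp Require Import reals metric_structure.

Set Implicit Arguments.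
Unset Strict Implicit.
Unset Printing Implicit Defensive.

Import Order.TTheory GRing.Theory Num.Theory.
Local Open Scope ring_scope.

(* The index set {+1, -1, +2, -2}: (s, k) stands for k + 1 if s = true
   and for - (k + 1) if s = false. *)
Definition sidx : finType := (bool * 'I_2)%type.

Definition sopp (i : sidx) : sidx := (~~ i.1, i.2).

(* (1, delta)-hyperbolicity. The permutation alpha may have fixed points; only
   alpha = -id is excluded. *)
Definition hyperbolic1 (R : realType) (X : metricType R) (delta : R) : Prop :=
  forall x : sidx -> X, exists alpha : {perm sidx},
    ~ (alpha =1 sopp) /\
    \sum_(i : sidx) mdist (x i) (x (sopp i)) <=
      \sum_(i : sidx) mdist (x i) (x (alpha i)) + 2 * delta.

Definition gromov_hyperbolic (R : realType) (X : metricType R) (delta : R) :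
    Prop :=
  forall x x' y y' : X,
    mdist x x' + mdist y y' <=
      Num.max (mdist x y + mdist x' y') (mdist x y' + mdist x' y) + 2 * delta.

(* Main.v *)
(** The points [x_1, x_-1, x_2, x_-2] have three matching sums:
    [S = d(x_1, x_-1) + d(x_2, x_-2)] and the two others, [T] and [T']. A 4-cycle
    containing two antipodal steps has sum [S + T] (or [S + T']), so that
    [2 S <= S + T + 2 delta] is just [S <= T + 2 delta]. Conversely, by the
    triangle inequality, [2 S <= sum + 2 delta] for any permutation other than
    [-id] forces [S <= max T T' + 2 delta]. *)
Require Import Defs.
From mathcomp Require Import all_boot all_order all_algebra.
From mathcomp Require Import perm lra.
From mathcomp Require Import reals metric_structure.
Import Order.TTheory GRing.Theory Num.Theory.
Local Open Scope ring_scope.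

Definition quad (T : Type) (a a' b b' : T) (i : sidx) : T :=
  if i.2 == ord0 then (if i.1 then a else a') else (if i.1 then b else b').

Local Notation p1 := ((true, ord0) : sidx).
Local Notation m1 := ((false, ord0) : sidx).
Local Notation p2 := ((true, lift ord0 ord0) : sidx).
Local Notation m2 := ((false, lift ord0 ord0) : sidx).

Lemma sum_sidx (R : realType) (F : sidx -> R) :
  \sum_(i : sidx) F i = F p1 + F m1 + F p2 + F m2.
Proof.
have -> : \sum_(i : sidx) F i = \sum_(s : bool) \sum_(k < 2) F (s, k).
  by rewrite pair_big; apply: eq_bigr => -[].
rewrite big_bool /= !big_ord_recl !big_ord0 /=; lra.
Qed.

Lemma sidxP (P : sidx -> Prop) : P p1 -> P m1 -> P p2 -> P m2 -> forall i, P i.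
Proof.
move=> h1 h2 h3 h4 [s k].
have [->|->] : k = ord0 \/ k = lift ord0 ord0.
- by case: k => -[|[|//]] hk; [left|right]; apply: val_inj.
- by case: s.
- by case: s.
Qed.

Lemma soppK : involutive sopp.
Proof. by case=> s k; rewrite /sopp /= negbK. Qed.

(** When [u] and [v] are distinct and not antipodal, this is a 4-cycle that still sends two indices
    to their antipodes. *)
Definition sopp_tperm (u v : sidx) : {perm sidx} :=
  (perm (inv_inj soppK) * tperm u v)%g.

Lemma sopp_tpermE u v i : sopp_tperm u v i = tperm u v (sopp i).
Proof. by rewrite permM permE. Qed.

Lemma sopp_tperm_neq u v : u != v -> ~ (sopp_tperm u v =1 sopp).
Proof.
move=> uv /(_ (sopp u)); rewrite sopp_tpermE soppK tpermL => vu.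
by rewrite vu eqxx in uv.
Qed.

Lemma matching_le_max (R : realType) (d : sidx -> sidx -> R) (delta : R)
    (al : {perm sidx}) :
  (forall i, d i i = 0) -> (forall i j, 0 <= d i j) ->
  (forall i j, d i j = d j i) -> (forall i j k, d i k <= d i j + d j k) ->
  0 <= delta -> ~ (al =1 sopp) ->
  \sum_(i : sidx) d i (sopp i) <= \sum_(i : sidx) d i (al i) + 2 * delta ->
  d p1 m1 + d p2 m2 <=
    Num.max (d p1 p2 + d m1 m2) (d p1 m2 + d m1 p2) + 2 * delta.
Proof.
move=> refl ge0 sym tri delta0 al_neq; rewrite !sum_sidx /sopp /=.
(* From here on [M] is only known as an upper bound of both sums, which keeps the goal linear. *)
set M : R := Num.max _ _.
have le_M : d p1 p2 + d m1 m2 <= M by rewrite le_max lexx.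
have le_M' : d p1 m2 + d m1 p2 <= M by rewrite le_max lexx orbT.
have {al_neq} : ~ [/\ al p1 = m1, al m1 = p1, al p2 = m2 & al m2 = p2].
  by case=> e1 e2 e3 e4; apply: al_neq; apply: sidxP.
have inj i j : i != j -> al i != al j by rewrite (inj_eq perm_inj).
have := inj p1 m1 isT; have := inj p1 p2 isT; have := inj p1 m2 isT.
have := inj m1 p2 isT; have := inj m1 m2 isT; have := inj p2 m2 isT.
(* Fixed points of [al] are harmless: the first four triangle inequalities treat
   a transposition of antipodes, the last four treat the 3-cycles. *)
have := (ge0 p1 p2, ge0 m1 m2, ge0 p1 m2, ge0 m1 p2).
have := (tri p1 p2 m1, tri p1 m2 m1, tri p2 p1 m2, tri p2 m1 m2).
have := (tri m1 m2 p2, tri m1 p2 m2, tri p1 m1 p2, tri m1 p1 p2).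
have symE := (sym m1 p1, sym m2 p2, sym p2 p1, sym m2 m1, sym m2 p1, sym p2 m1).
rewrite !symE.
(* Of the 256 value tables for [al], injectivity leaves 24; [lra] settles all but [-id], which
   [not_sopp] excludes. *)
move: M le_M le_M' (al p1) (al m1) (al p2) (al m2) => M le_M le_M' i1 i2 i3 i4.
move=> [[[t1 t2] t3] t4] [[[t5 t6] t7] t8] [[[g1 g2] g3] g4].
elim/sidxP: i1; elim/sidxP: i2 => //; elim/sidxP: i3 => //;
  elim/sidxP: i4 => // _ _ _ _ _ _ not_sopp; rewrite ?refl ?symE => le_al.
all: try lra.
by case: not_sopp.
Qed.

Lemma hyperbolic1_gromov (R : realType) (X : metricType R) (delta : R) :
  0 <= delta -> hyperbolic1 X delta -> gromov_hyperbolic X delta.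
Proof.
move=> delta0 H a a' b b'; set x := quad X a a' b b'.
have [al [al_neq le_al]] := H x.
apply: (@matching_le_max R (fun i j => mdist (x i) (x j)) delta al) => // *.
- exact: mdistxx.
- exact: mdist_ge0.
- exact: metric_sym.
- exact: metric_triangle.
Qed.

Lemma gromov_hyperbolic1 (R : realType) (X : metricType R) (delta : R) :
  gromov_hyperbolic X delta -> hyperbolic1 X delta.
Proof.
move=> H x; have sym i j : mdist (x i) (x j) = mdist (x j) (x i) by exact: metric_sym.
have := H (x p1) (x m1) (x p2) (x m2).
rewrite -lerBlDr le_max => /orP[] le_S.
(* The cycle [p1], [m1], [m2], [p2], of sum [S + T]. *)
- exists (sopp_tperm p1 m2); split; first exact: sopp_tperm_neq.
  rewrite !sum_sidx !sopp_tpermE !permE /= /sopp /=.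
  by have := (sym m1 p1, sym m2 p2, sym p2 p1); case=> [[? ?] ?]; lra.
(* The cycle [p1], [m1], [p2], [m2], of sum [S + T']. *)
- exists (sopp_tperm p1 p2); split; first exact: sopp_tperm_neq.
  rewrite !sum_sidx !sopp_tpermE !permE /= /sopp /=.
  by have := (sym m1 p1, sym m2 p2, sym m2 p1); case=> [[? ?] ?]; lra.
Qed.

Theorem proposition2p2 (R : realType) (X : metricType R) (delta : R)
  (hdelta : 0 <= delta) :
  hyperbolic1 X delta <-> gromov_hyperbolic X delta.
Proof.
split; [exact: hyperbolic1_gromov | exact: gromov_hyperbolic1].
Qed.
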